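(* Let $(u,\boldsymbol q)$ be the exact solution of the primal problem and let $s=\ell^O(u,\boldsymbol q)$ be the quantity of interest (see context). Let $(\tilde u_h,\tilde{\boldsymbol q}_h)$ and $(\tilde\xi_h,\tilde{\boldsymbol\zeta}_h)$ be potential and equilibrated flux reconstructions of the primal and adjoint problems, i.e. $$\tilde u_h,\tilde\xi_h\in H^1(\Omega),\qquad \tilde u_h=g_D \text{ on }\Gamma_D,\qquad \tilde\xi_h=g_D^O\text{ on }\Gamma_D,$$ $$\tilde{\boldsymbol q}_h,\tilde{\boldsymbol\zeta}_h\in H(\mathrm{div};\Omega),\qquad \nabla\cdot\tilde{\boldsymbol q}_h=f,\quad \nabla\cdot\tilde{\boldsymbol\zeta}_h=f^O\ \text{ in }\Omega,\qquad \tilde{\boldsymbol q}_h\cdot\boldsymbol n=g_N,\quad \tilde{\boldsymbol\zeta}_h\cdot\boldsymbol n=-g_N^O\ \text{ on }\Gamma_N.$$ Then $s_h^-\le s\le s_h^+$, where $$s_h^{-}=\ell^O(\tilde u_h,\tilde{\boldsymbol q}_h)+\tfrac12\big(\nu^{-1}(\tilde{\boldsymbol q}_h+\nu\nabla\tilde u_h),\,\tilde{\boldsymbol\zeta}_h-\nu\nabla\tilde\xi_h\big)-\tfrac12\,|||\tilde{\boldsymbol q}_h+\nu\nabla\tilde u_h|||\;|||\tilde{\boldsymbol\zeta}_h+\nu\nabla\tilde\xi_h|||,$$ $$s_h^{+}=\ell^O(\tilde u_h,\tilde{\boldsymbol q}_h)+\tfrac12\big(\nu^{-1}(\tilde{\boldsymbol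 q}_h+\nu\nabla\tilde u_h),\,\tilde{\boldsymbol\zeta}_h-\nu\nabla\tilde\xi_h\big)+\tfrac12\,|||\tilde{\boldsymbol q}_h+\nu\nabla\tilde u_h|||\;|||\tilde{\boldsymbol\zeta}_h+\nu\nabla\tilde\xi_h|||.$$
   Context: Setting. $\Omega\subset\mathbb R^d$, $d\in\{2,3\}$, is a polygonal/polyhedral domain with outward unit normal $\boldsymbol n$; $\partial\Omega=\overline{\Gamma}_D\cup\overline{\Gamma}_N$ with $\Gamma_D\cap\Gamma_N=\emptyset$ and $\Gamma_D$ non-empty (relatively open). The coefficient $\nu\in L^\infty(\Omega)$ is strictly positive and piecewise constant on (finitely many) subdomains of $\Omega$. Data: $f,f^O\in L^2(\Omega)$, $g_N,g_N^O\in L^2(\Gamma_N)$, $g_D,g_D^O\in C(\Gamma_D)$, regular enough that the problems below have solutions. Notation. $(\cdot,\cdot)$ is the $L^2(\Omega)$ inner product (scalar or vector valued). $\langle\cdot,\cdot\rangle_{\gamma}$ is the integral of the product over $\gamma\subset\partial\Omega$; when one factor is the normal trace of an $H(\mathrm{div};\Omega)$ field it is read as the corresponding duality pairing, so that the Green formula $(\boldsymbol v,\nabla w)+(\nabla\cdot\boldsymbol v,w)=\langle\boldsymbol v\cdot\boldsymbol n,w\rangle_{\Gamma_D}+\langle\boldsymbol v\cdot\boldsymbol n,w\rangle_{\Gamma_N}$ holds for $\boldsymbol v\in H(\mathrm{div};\Omega)$, $w\in H^1(\Omega)$. Here $H(\mathrm{div};\Omega)=\{\boldsymbol v\in[L^2(\Omega)]^d:\nabla\cdot\boldsymbol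 v\in L^2(\Omega)\}$. The energy norm is $|||\boldsymbol v|||=(\nu^{-1}\boldsymbol v,\boldsymbol v)^{1/2}$. Primal problem: $(u,\boldsymbol q)\in H^1(\Omega)\times H(\mathrm{div};\Omega)$ is the (weak) solution of $\boldsymbol q=-\nu\nabla u$ in $\Omega$, $\nabla\cdot\boldsymbol q=f$ in $\Omega$, $u=g_D$ on $\Gamma_D$, $\boldsymbol q\cdot\boldsymbol n=g_N$ on $\Gamma_N$. Adjoint problem: $(\xi,\boldsymbol\zeta)\in H^1(\Omega)\times H(\mathrm{div};\Omega)$ is the (weak) solution of $\boldsymbol\zeta=-\nu\nabla\xi$ in $\Omega$, $\nabla\cdot\boldsymbol\zeta=f^O$ in $\Omega$, $\xi=g_D^O$ on $\Gamma_D$, $\boldsymbol\zeta\cdot\boldsymbol n=-g_N^O$ on $\Gamma_N$. Output functional: $\ell^O(w,\boldsymbol v)=(f^O,w)+\langle g_D^O,\boldsymbol v\cdot\boldsymbol n\rangle_{\Gamma_D}+\langle g_N^O,w\rangle_{\Gamma_N}$, and $s=\ell^O(u,\boldsymbol q)$. *)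

(* Defs.v *)
From HB Require Import structures.
From mathcomp Require Import all_boot all_order all_algebra.
From mathcomp Require Import all_classical all_reals all_analysis.
From mathcomp Require Import measurable_realfun.

Set Implicit Arguments.
Unset Strict Implicit.
Unset Printing Implicit Defensive.

Import Order.TTheory GRing.Theory Num.Theory.
Import numFieldNormedType.Exports.

Local Open Scope classical_set_scope.
Local Open Scope ring_scope.

(* 'rV[R]_n carries the sigma-algebra generated by its coordinates, which is
   its Borel sigma-algebra. *)
Definition rV_display : measure_display. Proof. exact: default_measure_display. Qed.

Section measurable_rV.
Context (R : realType) (n : nat).

Let coord (i : 'I_n) (x : 'rV[R]_n) : R := x ord0 i.

Let rV_set0 : g_sigma_preimage coord set0.
Proof. exact: sigma_algebra0. Qed.

Let rV_setC A : g_sigma_preimage coord A -> g_sigma_preimage coord (~` A).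
Proof. exact: sigma_algebraC. Qed.

Let rV_bigcup (F : _^nat) : (forall i, g_sigma_preimage coord (F i)) ->
  g_sigma_preimage coord (\bigcup_i (F i)).
Proof. exact: sigma_algebra_bigcup. Qed.

HB.instance Definition _ := @isMeasurable.Build rV_display
  'rV[R]_n (g_sigma_preimage coord) rV_set0 rV_setC rV_bigcup.

End measurable_rV.


Lemma measurable_coord (R : realType) n (i : 'I_n) :
  measurable_fun [set: 'rV[R]_n] (fun x : 'rV[R]_n => x ord0 i).
Proof.
move=> _ Y mY; rewrite setTI; apply: sub_sigma_algebra.
rewrite -bigcup_seq/=; exists i => /=; first by rewrite mem_index_enum.
by exists Y => //; rewrite setTI.
Qed.

Lemma measurable_to_rV d (T : measurableType d) (R : realType) n
    (f : T -> 'rV[R]_n) :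
  (forall i, measurable_fun setT (fun x => f x ord0 i)) -> measurable_fun setT f.
Proof.
move=> mf; suff pref : g_sigma_preimage
    (fun i => (fun x : 'rV[R]_n => x ord0 i) \o f) `<=` measurable.
  move: pref; rewrite g_sigma_preimage_comp => pref _ A mA.
  by apply: pref; exists A.
apply: smallest_sub; first exact: sigma_algebra_measurable.
move=> A; rewrite -bigcup_seq/= => -[i _ [B mB <-]].
exact: mf.
Qed.

Definition snoc_rV (R : realType) n (p : 'rV[R]_n * R) : 'rV[R]_n.+1 :=
  \row_i (if unlift ord_max i is Some j then p.1 ord0 j else p.2).

Lemma measurable_snoc_rV (R : realType) n :
  measurable_fun setT (@snoc_rV R n : _ -> 'rV[R]_n.+1).
Proof.
apply: measurable_to_rV => i; rewrite /snoc_rV.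
under eq_fun do rewrite mxE.
case: (unlift ord_max i) => [j|]; last exact: measurable_snd.
exact: (measurableT_comp (measurable_coord j) measurable_fst).
Qed.

Definition image_measure d1 d2 (T1 : measurableType d1) (T2 : measurableType d2)
    (R : realType) (m : {measure set T1 -> \bar R}) (f : T1 -> T2)
    (mf : measurable_fun setT f) : {measure set T2 -> \bar R} :=
  measure_function_pushforward__canonical__measure_function_Measure m mf.

Fixpoint lebesgue_rV (R : realType) n : {measure set 'rV[R]_n -> \bar R} :=
  match n with
  | 0%N => \d_(0 : 'rV[R]_0)
  | n'.+1 => image_measure
      ((lebesgue_rV R n') \x (@lebesgue_measure R))%E (@measurable_snoc_rV R n')
  end.
Arguments lebesgue_rV {R n}.

(* A facet in R^(n+1) is a simplex given by its n+1 vertices, the rows of F.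
   It is parametrised over the reference simplex of R^n. *)
Section facets.
Context (R : realType) (n : nat).
Implicit Types F : 'M[R]_n.+1.

Definition ref_simplex : set 'rV[R]_n :=
  [set x | (forall i, 0 <= x ord0 i) /\ \sum_i x ord0 i <= 1].

Definition open_ref_simplex : set 'rV[R]_n :=
  [set x | (forall i, 0 < x ord0 i) /\ \sum_i x ord0 i < 1].

Definition facet_edges F : 'M[R]_(n, n.+1) :=
  \matrix_(i, j) (F (lift ord0 i) j - F ord0 j).

Definition facet_map F (x : 'rV[R]_n) : 'rV[R]_n.+1 :=
  row ord0 F + x *m facet_edges F.

Definition facet F : set 'rV[R]_n.+1 := facet_map F @` ref_simplex.

Definition relint_facet F : set 'rV[R]_n.+1 := facet_map F @` open_ref_simplex.

(* Square root of the Gram determinant: the constant density of the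
   n-dimensional surface measure in the parametrisation facet_map F. *)
Definition facet_jacobian F : R :=
  Num.sqrt (\det (facet_edges F *m (facet_edges F)^T)).

Lemma facet_jacobian_ge0 F : 0 <= facet_jacobian F.
Proof. exact: sqrtr_ge0. Qed.

Lemma measurable_ref_simplex : measurable ref_simplex.
Proof.
have -> : ref_simplex = (\bigcap_(i in [set: 'I_n])
    ((fun x : 'rV[R]_n => x ord0 i) @^-1` `[0, +oo[)) `&`
    ((fun x : 'rV[R]_n => \sum_i x ord0 i) @^-1` `]-oo, 1]).
  apply/seteqP; split => x /=.
    by move=> [x0 x1]; split; [move=> i _ /=; rewrite in_itv/= x0|rewrite in_itv].
  move=> [x0]; rewrite in_itv/= => x1; split => // i.
  by have := x0 i Logic.I; rewrite /= in_itv/= andbT.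
apply: measurableI.
  apply: fin_bigcap_measurable => // i _.
  by rewrite -[X in measurable X]setTI; exact: measurable_coord.
rewrite -[X in measurable X]setTI.
have mS : measurable_fun setT (fun x : 'rV[R]_n => \sum_(i < n) x ord0 i).
  by apply: measurable_sum => i; exact: measurable_coord.
exact: mS.
Qed.

Lemma measurable_facet_map F : measurable_fun setT (facet_map F).
Proof.
apply: measurable_to_rV => i; rewrite /facet_map.
under eq_fun do rewrite !mxE.
apply: measurable_funD => //; apply: measurable_sum => j.
by apply: measurable_funM => //; exact: measurable_coord.
Qed.

Definition facet_measure F : {measure set 'rV[R]_n.+1 -> \bar R} :=
  mscale (NngNum (facet_jacobian_ge0 F))
    (image_measure (mrestr lebesgue_rV measurable_ref_simplex)
       (measurable_facet_map F)).

End facets.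

Definition boundary (T : topologicalType) (A : set T) : set T :=
  closure A `\` A°.

(* The ambient space is R^(n+1).  dom_regular excludes slits, i.e., parts of
   the boundary with the domain on both sides. *)
Record polyhedral_domain (R : realType) (n : nat) := PolyhedralDomain {
  dom :> set 'rV[R]_n.+1 ;
  dom_facets : seq 'M[R]_n.+1 ;
  dom_nonempty : dom !=set0 ;
  dom_open : open dom ;
  dom_connected : connected dom ;
  dom_bounded : bounded_set dom ;
  dom_regular : (closure dom)° = dom ;
  dom_boundary : boundary dom = \bigcup_(F in [set` dom_facets]) facet F ;
  facets_nondegenerate : forall F, F \in dom_facets -> 0 < facet_jacobian F ;
  facets_nonoverlapping : forall i j, (i < j < size dom_facets)%N ->
    relint_facet (nth 0 dom_facets i) `&` relint_facet (nth 0 dom_facets j)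
      = set0 }.

Definition surface_measure (R : realType) n (Omega : polyhedral_domain R n) :
    {measure set 'rV[R]_n.+1 -> \bar R} :=
  msum (fun k => facet_measure (nth 0 (dom_facets Omega) k))
    (size (dom_facets Omega)).

Definition boundary_partition (R : realType) n (Omega : polyhedral_domain R n)
    (GammaD GammaN : set 'rV[R]_n.+1) : Prop :=
  [/\ GammaD !=set0,
      exists2 U, open U & GammaD = U `&` boundary Omega,
      exists2 U, open U & GammaN = U `&` boundary Omega,
      GammaD `&` GammaN = set0 &
      boundary Omega = closure GammaD `|` closure GammaN].

Section L2.
Context d (T : measurableType d) (R : realType) (mu : {measure set T -> \bar R}).

Definition L2 (D : set T) (f : T -> R) : Prop := f \_ D \in Lfun mu 2%:E.

Definition L2norm (D : set T) (f : T -> R) : \bar R :=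
  'N[mu]_2%:E [EFin \o (f \_ D)]%E.

End L2.

Definition dot (R : realType) n (x y : 'rV[R]_n) : R :=
  \sum_i x ord0 i * y ord0 i.

Section smooth.
Context (R : realType) (n : nat).

Definition partial (i : 'I_n) (f : 'rV[R]_n -> R) (x : 'rV[R]_n) : R :=
  'D_(delta_mx ord0 i) f x.

Definition gradient (f : 'rV[R]_n -> R) (x : 'rV[R]_n) : 'rV[R]_n :=
  \row_i partial i f x.

Fixpoint Ck (k : nat) (f : 'rV[R]_n -> R) : Prop :=
  match k with
  | 0%N => continuous f
  | k'.+1 => [/\ continuous f,
      forall i x, derivable f x (delta_mx ord0 i) &
      forall i, Ck k' (partial i f)]
  end.

Definition smooth (f : 'rV[R]_n -> R) : Prop := forall k, Ck k f.

Definition test_function (A : set 'rV[R]_n) (f : 'rV[R]_n -> R) : Prop :=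
  smooth f /\
  exists K, [/\ compact K, K `<=` A & forall x, ~ K x -> f x = 0].

End smooth.

Section sobolev.
Context (R : realType) (n : nat) (Omega : polyhedral_domain R n).
Local Notation space := 'rV[R]_n.+1.
Local Notation leb := (@lebesgue_rV R n.+1).
Local Notation surf := (surface_measure Omega).

Definition L2vec (v : space -> space) : Prop :=
  forall i, L2 leb Omega (fun x => v x ord0 i).

Definition is_weak_gradient (w : space -> R) (G : space -> space) : Prop :=
  forall phi, test_function Omega phi -> forall i,
    \int[leb]_(x in Omega) (w x * partial i phi x) =
    - \int[leb]_(x in Omega) (G x ord0 i * phi x).

Definition is_weak_divergence (v : space -> space) (dv : space -> R) : Prop :=
  forall phi, test_function Omega phi ->
    \int[leb]_(x in Omega) dot (v x) (gradient phi x) =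
    - \int[leb]_(x in Omega) (dv x * phi x).

(* The trace operator is the continuous extension to H^1 of the restriction to
   the boundary of functions smooth up to the boundary; this is its graph. *)
Definition is_trace (w : space -> R) (G : space -> space) (t : space -> R) :
    Prop :=
  L2 surf (boundary Omega) t /\
  exists phi : nat -> space -> R,
  [/\ forall k, smooth (phi k),
      L2norm leb Omega (fun x => phi k x - w x) @[k --> \oo] --> 0%E,
      forall i, L2norm leb Omega (fun x => partial i (phi k) x - G x ord0 i)
        @[k --> \oo] --> 0%E &
      L2norm surf (boundary Omega) (fun x => phi k x - t x)
        @[k --> \oo] --> 0%E].

(* An element of H^1(Omega) is a function bundled with representatives of its
   weak gradient and of its trace.  Both are determined by the function up to
   null sets, and the trace exists by the trace theorem, so that the bundling
   puts no restriction on the function. *)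
Record H1 := MkH1 {
  H1_fun :> space -> R ;
  grad : space -> space ;
  trace : space -> R ;
  H1_L2 : L2 leb Omega H1_fun ;
  grad_L2 : L2vec grad ;
  gradP : is_weak_gradient H1_fun grad ;
  traceP : is_trace H1_fun grad trace }.

Record Hdiv := MkHdiv {
  Hdiv_fun :> space -> space ;
  divergence : space -> R ;
  Hdiv_L2 : L2vec Hdiv_fun ;
  divergence_L2 : L2 leb Omega divergence ;
  divergenceP : is_weak_divergence Hdiv_fun divergence }.

Definition trace_eq (Gamma : set space) (w : H1) (g : space -> R) : Prop :=
  \forall x \ae surf, Gamma x -> trace w x = g x.

Definition boundary_ip (Gamma : set space) (g h : space -> R) : R :=
  \int[surf]_(x in Gamma) (g x * h x).

Definition ip (f g : space -> R) : R := \int[leb]_(x in Omega) (f x * g x).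

Definition vec_ip (v w : space -> space) : R :=
  \int[leb]_(x in Omega) dot (v x) (w x).

(* <v.n, w> over the whole boundary: the normal trace of a field in H(div) is
   the functional given by Green's formula, and the normal vector appears only
   through it. *)
Definition normal_pairing (v : Hdiv) (w : H1) : R :=
  vec_ip v (grad w) + ip (divergence v) w.

Section parts.
Context (GammaD GammaN : set space).

(* v.n = h on GammaN.  As the normal trace of v is a functional, this is tested
   against the w in H^1 that vanish on GammaD. *)
Definition normal_trace_eq (v : Hdiv) (h : space -> R) : Prop :=
  L2 surf GammaN h /\
  forall w : H1, trace_eq GammaD w (fun=> 0) ->
    normal_pairing v w = boundary_ip GammaN h (trace w).

(* The function v.n on GammaN if v has a square-integrable normal trace there
   (it is then unique up to null sets), and 0 otherwise. *)
Definition normal_traceN (v : Hdiv) : space -> R :=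
  xget (fun=> 0) [set h : space -> R | normal_trace_eq v h].

(* <v.n, w> over GammaD, so that the pairings over GammaD and GammaN add up to
   the one over the whole boundary. *)
Definition normal_pairingD (v : Hdiv) (w : H1) : R :=
  normal_pairing v w - boundary_ip GammaN (normal_traceN v) (trace w).

(* <g, v.n> over GammaD for boundary data g; if v has a square-integrable
   normal trace on GammaN, then all w with trace g on GammaD give the same
   value. *)
Definition dual_pairingD (g : space -> R) (v : Hdiv) : R :=
  get [set r | exists2 w : H1, trace_eq GammaD w g & r = normal_pairingD v w].

End parts.
End sobolev.

Section problem.
Context (R : realType) (n : nat) (Omega : polyhedral_domain R n)
  (GammaD GammaN : set 'rV[R]_n.+1) (nu : 'rV[R]_n.+1 -> R).
Local Notation space := 'rV[R]_n.+1.
Local Notation leb := (@lebesgue_rV R n.+1).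
Local Notation surf := (surface_measure Omega).

(* The values on the finitely many subdomains bound nu almost everywhere, so
   that nu and 1/nu are in L^oo. *)
Definition diffusion_coefficient : Prop :=
  [/\ measurable_fun Omega nu,
      forall x, dom Omega x -> 0 < nu x &
      exists (N : nat) (sub : 'I_N -> set space) (c : 'I_N -> R),
      [/\ forall k, [/\ open (sub k), connected (sub k) & sub k `<=` Omega],
          trivIset setT sub,
          forall k x, sub k x -> nu x = c k &
          \forall x \ae leb, dom Omega x -> exists k, sub k x]].

Definition admissible_data (f gD gN : space -> R) : Prop :=
  [/\ L2 leb Omega f, {within GammaD, continuous gD} & L2 surf GammaN gN].

Definition reconstruction (f gD gN : space -> R)
    (u : H1 Omega) (q : Hdiv Omega) : Prop :=
  [/\ trace_eq GammaD u gD,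
      \forall x \ae leb, dom Omega x -> divergence q x = f x &
      normal_trace_eq GammaD GammaN q gN].

Definition weak_solution (f gD gN : space -> R)
    (u : H1 Omega) (q : Hdiv Omega) : Prop :=
  (\forall x \ae leb, dom Omega x -> q x = - (nu x *: grad u x)) /\
  reconstruction f gD gN u q.

Definition output_functional (f gD gN : space -> R)
    (w : H1 Omega) (v : Hdiv Omega) : R :=
  ip Omega f w + dual_pairingD GammaD GammaN gD v
  + boundary_ip Omega GammaN gN (trace w).

Definition energy_ip (v w : space -> space) : R :=
  vec_ip Omega (fun x => (nu x)^-1 *: v x) w.

Definition energy_norm (v : space -> space) : R := Num.sqrt (energy_ip v v).

End problem.

(* Main.v *)
(* Write A = q - qh and B = nu grad(u - uh), so that A + B = -(qh + nu grad uh)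
   by the constitutive law, and let (.,.) below be the energy inner product.
   Testing zetah with u - uh and A with xih in Green's formula gives
   s - ell(uh, qh) = (A, nu grad xih) - (zetah, B).  Moreover A and B are
   orthogonal, since A is divergence free with zero flux through GammaN and
   u - uh vanishes on GammaD.  The error minus the correction term is then
   1/2 (A - B, zetah + nu grad xih), and |||A - B||| = |||A + B|||, so that
   Cauchy-Schwarz concludes. *)

Require Import Defs.
From mathcomp Require Import all_boot all_order all_algebra.
From mathcomp Require Import all_classical all_reals all_analysis.
From mathcomp Require Import measurable_realfun.
From mathcomp Require Import ring lra.

Set Implicit Arguments.
Unset Strict Implicit.
Unset Printing Implicit Defensive.

Import Order.TTheory GRing.Theory Num.Theory.
Import numFieldNormedType.Exports.

Local Open Scope classical_set_scope.
Local Open Scope ring_scope.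

(** * Square-integrable functions *)

Section square_integrable.
Context d (T : measurableType d) (R : realType).
Variable mu : {measure set T -> \bar R}.
Implicit Types (D E : set T) (f g : T -> R).

Lemma L2_measurable D f : L2 mu D f -> measurable_fun setT (f \_ D).
Proof. by rewrite /L2 inE => /andP[+ _]; rewrite inE. Qed.

(** Trades the norm, defined through real powers of absolute values, for the integral of a plain
    square, which comparison of integrals handles directly. *)
Lemma L2P D f : L2 mu D f <->
  measurable_fun setT (f \_ D) /\
  (\int[mu]_x (((f \_ D) x) ^+ 2)%:E < +oo)%E.
Proof.
split=> [L2f|[mf foo]].
  split; first exact: L2_measurable.
  have /integrableP[_] := Lfun2_integrable_sqr L2f.
  apply: le_lt_trans; rewrite le_eqVlt; apply/orP; left; apply/eqP.
  by apply: eq_integral => x _ /=; rewrite ger0_norm ?sqr_ge0.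
rewrite /L2 inE; apply/andP; split; rewrite inE//=.
rewrite /finite_norm unlock poweR_lty//=.
under eq_integral => x _ do
  rewrite /= powR_mulrn ?normr_ge0// real_normK ?num_real//.
exact: foo.
Qed.

Lemma L2_le D f g : measurable_fun setT (f \_ D) -> L2 mu D g ->
  {ae mu, forall x, `|(f \_ D) x| <= `|(g \_ D) x|} -> L2 mu D f.
Proof.
move=> mf /L2P[mg goo] fg; apply/L2P; split => //.
apply: le_lt_trans goo; apply: (ae_ge0_le_integral measurableT) => //.
- by move=> x _; rewrite lee_fin sqr_ge0.
- by apply/measurable_EFinP; exact: measurable_funX.
- by move=> x _; rewrite lee_fin sqr_ge0.
- by apply/measurable_EFinP; exact: measurable_funX.
- move: fg; apply: filterS => x fg _; rewrite lee_fin.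
  rewrite -[leLHS]real_normK ?num_real// -[leRHS]real_normK ?num_real//.
  by rewrite lerXn2r ?nnegrE.
Qed.

Lemma L2Z D f (k : R) : L2 mu D f -> L2 mu D (fun x => k * f x).
Proof.
rewrite /L2; have -> : (fun x => k * f x) \_ D = k \o* (f \_ D).
  apply/funext => x; rewrite /patch /=.
  by case: ifPn => _; rewrite ?mul0r 1?mulrC.
by move=> L2f; apply: Lfun_scale => //; rewrite ler1n.
Qed.

Lemma L2D D f g : L2 mu D f -> L2 mu D g -> L2 mu D (fun x => f x + g x).
Proof.
rewrite /L2; have -> : (fun x => f x + g x) \_ D = f \_ D + g \_ D.
  apply/funext => x; rewrite addrfctE /patch.
  by case: ifPn => _; rewrite ?addr0.
move=> L2f L2g.
have [_] := Lfun_addr_closed mu (lee1n 2 : (1 <= 2%:E :> \bar R)%E).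
exact.
Qed.

Lemma L2B D f g : L2 mu D f -> L2 mu D g -> L2 mu D (fun x => f x - g x).
Proof.
move=> L2f L2g; have := L2D L2f (L2Z (-1) L2g).
by under [X in L2 mu D X -> _]eq_fun do rewrite mulN1r.
Qed.

Lemma L2_bounded_mul D (m f : T -> R) (M : R) : measurable_fun setT (m \_ D) ->
  {ae mu, forall x, D x -> `|m x| <= M} -> L2 mu D f ->
  L2 mu D (fun x => m x * f x).
Proof.
move=> mm mM L2f; apply: L2_le (L2Z M L2f) _.
  have -> : (fun x => m x * f x) \_ D = (m \_ D) \* (f \_ D).
    by apply/funext => x; rewrite /patch /=; case: ifPn; rewrite ?mul0r.
  by apply: measurable_funM => //; exact: L2_measurable L2f.
move: mM; apply: filterS => x mM; rewrite /patch; case: ifPn => // /set_mem Dx.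
rewrite !normrM ler_wpM2r//; have := mM Dx.
(* No sign is known for [M], so the dominating function is [M * f], of absolute value [|M| |f|], and
   [M <= |M|] closes the gap. *)
by move=> /le_trans; apply; exact: ler_norm.
Qed.

(* Integrating the restriction over the whole space spares assuming D measurable,
   which matters for the pieces of the boundary. *)
Definition integrable_on D f := mu.-integrable setT (EFin \o f \_ D).

(** Two sets appear because Neumann data are square integrable on [GammaN], whereas traces are so on
    the whole boundary. The product of the two restrictions is already supported in [D]. *)
Lemma integrable_onM D E f g : D `<=` E -> L2 mu D f -> L2 mu E g ->
  integrable_on D (fun x => f x * g x).
Proof.
move=> DE L2f L2g.
have /Lfun1_integrable := Lfun2_mul_Lfun1 L2f L2g.
rewrite /integrable_on; congr (mu.-integrable setT _).
apply/funext => x; rewrite /patch /=; case: ifPn => [/set_mem Dx|].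
  by rewrite mem_set//; exact: DE.
by rewrite mul0r.
Qed.

Lemma integrable_onD D f g : integrable_on D f -> integrable_on D g ->
  integrable_on D (fun x => f x + g x).
Proof.
move=> intf intg; have := integrableD measurableT intf intg.
apply: eq_integrable => // x _.
by rewrite /patch /=; case: ifPn; rewrite ?adde0.
Qed.

Lemma integrable_onZ D f (k : R) : integrable_on D f ->
  integrable_on D (fun x => k * f x).
Proof.
move=> intf; have := integrableZl measurableT k intf.
apply: eq_integrable => // x _.
by rewrite /patch /=; case: ifPn; rewrite ?mule0.
Qed.

Lemma integrable_on_sum D (I : Type) (s : seq I) (F : I -> T -> R) :
  (forall i, integrable_on D (F i)) ->
  integrable_on D (fun x => \sum_(i <- s) F i x).
Proof.
move=> intF; elim: s => [|i s IH].
  rewrite /integrable_on.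
  have -> : EFin \o (fun x => \sum_(i <- [::]) F i x) \_ D = cst 0%E.
    by apply/funext => x; rewrite /patch /= big_nil; case: ifP.
  exact: integrable0.
under eq_fun do rewrite big_cons.
exact: integrable_onD.
Qed.

Lemma Rintegral_onD D f g : integrable_on D f -> integrable_on D g ->
  \int[mu]_(x in D) (f x + g x) = \int[mu]_(x in D) f x + \int[mu]_(x in D) g x.
Proof.
move=> intf intg; rewrite !(Rintegral_mkcond mu D) -RintegralD//.
apply: eq_Rintegral => x _; rewrite /patch.
by case: ifPn; rewrite ?addr0.
Qed.

Lemma Rintegral_onZ D f (k : R) : integrable_on D f ->
  \int[mu]_(x in D) (k * f x) = k * \int[mu]_(x in D) f x.
Proof.
move=> intf; rewrite !(Rintegral_mkcond mu D) -RintegralZl//.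
apply: eq_Rintegral => x _; rewrite /patch.
by case: ifPn; rewrite ?mulr0.
Qed.

Lemma Rintegral_onB D f g : integrable_on D f -> integrable_on D g ->
  \int[mu]_(x in D) (f x - g x) = \int[mu]_(x in D) f x - \int[mu]_(x in D) g x.
Proof.
move=> intf intg.
under eq_Rintegral do rewrite -mulN1r.
by rewrite Rintegral_onD ?Rintegral_onZ ?mulN1r//; exact: integrable_onZ.
Qed.

Lemma ae_eq_Rintegral_on D f g : integrable_on D f -> integrable_on D g ->
  {ae mu, forall x, D x -> f x = g x} ->
  \int[mu]_(x in D) f x = \int[mu]_(x in D) g x.
Proof.
move=> intf intg fg; rewrite !(Rintegral_mkcond mu D) /Rintegral; congr fine.
apply: ae_eq_integral => //; first exact: measurable_int intf.
  exact: measurable_int intg.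
move: fg; apply: filterS => x fg _; rewrite /patch.
by case: ifPn => // /set_mem Dx; rewrite fg.
Qed.

(** Minkowski's inequality squeezes the norm between 0 and a sum of two null sequences. The
    measurability hypotheses are those of Minkowski. *)
Lemma L2norm_cvgB D (f g : nat -> T -> R) (f0 g0 : T -> R) :
  (forall k, measurable_fun setT ((fun x => f k x - f0 x) \_ D)) ->
  (forall k, measurable_fun setT ((fun x => g k x - g0 x) \_ D)) ->
  L2norm mu D (fun x => f k x - f0 x) @[k --> \oo] --> 0%E ->
  L2norm mu D (fun x => g k x - g0 x) @[k --> \oo] --> 0%E ->
  L2norm mu D (fun x => (f k x - g k x) - (f0 x - g0 x)) @[k --> \oo] --> 0%E.
Proof.
move=> mf mg cf cg.
apply: (@squeeze_cvge _ _ _ _ (cst 0%E) _ (fun k =>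
    L2norm mu D (fun x => f k x - f0 x)%R +
    L2norm mu D (fun x => g k x - g0 x)%R)%E).
- apply: nearW => k; apply/andP; split; first exact: Lnorm_ge0.
  have -> : L2norm mu D (fun x => (f k x - g k x) - (f0 x - g0 x)) =
      'N[mu]_2%:E[EFin \o
        (((fun x => f k x - f0 x) \_ D) \+
         (\- ((fun x => g k x - g0 x) \_ D))%R)%R]%E.
    rewrite /L2norm; congr Lnorm; apply/funext => x; rewrite /patch/=.
    by case: ifPn => _; rewrite ?subr0//; congr EFin; ring.
  apply: le_trans (minkowski_EFin _ _ _ _) _ => //.
  + exact: measurableT_comp.
  + by rewrite ler1n.
  + rewrite leeD2l// /L2norm -oppe_Lnorm le_eqVlt; apply/orP; left; apply/eqP.
    by congr Lnorm; apply/funext => x /=; rewrite opprK.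
- exact: cvg_cst.
- by rewrite -[X in _ --> X]adde0; apply: cvgeD.
Qed.

End square_integrable.

(** * Lebesgue measure on row vectors *)

Section measure_rV.
Context (R : realType).

(** Rational centres and radii 1/(k+1) make the family of boxes countable. *)
Let box n (c : 'rV[rat]_n) (k : nat) : set 'rV[R]_n :=
  [set y | forall i, `|y ord0 i - ratr (c ord0 i)| < k.+1%:R^-1].

Lemma measurable_box n (A : 'I_n -> set R) :
  (forall i, measurable (A i)) ->
  measurable [set x : 'rV[R]_n | forall i, A i (x ord0 i)].
Proof.
move=> mA.
have -> : [set x : 'rV[R]_n | forall i, A i (x ord0 i)] =
    \bigcap_(i in [set: 'I_n]) ((fun x : 'rV[R]_n => x ord0 i) @^-1` A i).
  by apply/seteqP; split => x /= Ax i => [_|]; exact: Ax.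
apply: fin_bigcap_measurable => // i _.
by rewrite -[X in measurable X]setTI; exact: measurable_coord.
Qed.

(** Links the norm topology to the sigma-algebra generated by the coordinates: an open set is the
    union of the countably many rational boxes that it contains. *)
Lemma open_measurable_rV n (U : set 'rV[R]_n) : open U -> measurable U.
Proof.
move=> oU.
have -> : U = \bigcup_(ck : 'rV[rat]_n * nat)
    (if `[< box ck.1 ck.2 `<=` U >] then box ck.1 ck.2 else set0).
  apply/seteqP; split => [x Ux|x [ck _]]; last by case: asboolP => // subU /subU.
  have /nbhs_ballP[e /= e0 xeU] : nbhs x U by exact: open_nbhs_nbhs.
  have e2 : 0 < e / 2 by rewrite divr_gt0.
  (* By the triangle inequality in each coordinate, a box of radius below e/2 that contains [x] lies
     in the ball of radius e around [x]. *)
  have [k ke] : exists k : nat, k.+1%:R^-1 < e / 2.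
    exists (Num.truncn (e / 2)^-1).
    by rewrite invf_plt ?posrE// truncnS_gt.
  have k0 : 0 < k.+1%:R^-1 :> R by rewrite invr_gt0.
  have /choice[c cx] (i : 'I_n) :
      exists q : rat, ratr q \in `]x ord0 i - k.+1%:R^-1, x ord0 i + k.+1%:R^-1[.
    by apply: rat_in_itvoo; rewrite ltrBlDr -addrA ltrDl addr_gt0.
  have cx' i : `|x ord0 i - ratr (c i)| < k.+1%:R^-1.
    by have := cx i; rewrite in_itv/= distrC ltr_distl.
  exists (\row_i c i, k) => //=; case: asboolP => [_|].
    by move=> i; rewrite mxE.
  case=> y /= yc; apply: xeU; split => // i j; rewrite ord1 -ball_normE /ball_ /=.
  have := yc j; rewrite mxE => ycj.
  rewrite (le_lt_trans (ler_distD (ratr (c j)) _ _))// [ltRHS](splitr e).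
  by rewrite ltrD ?(lt_trans (cx' j))// distrC (lt_trans ycj).
apply: countable_bigcupT_measurable => // -[c k] /=; case: ifP => // _.
apply: (@measurable_box n
  (fun i => [set y | `|y - ratr (c ord0 i)| < k.+1%:R^-1])) => i.
apply: open_measurable.
rewrite (_ : [set _ | _] = ball (ratr (c ord0 i) : R) k.+1%:R^-1).
  exact: ball_open.
by rewrite -ball_normE; apply/seteqP; split => y; rewrite /ball_/= distrC.
Qed.

Lemma continuous_measurable_rV n (f : 'rV[R]_n -> R) :
  continuous f -> measurable_fun setT f.
Proof.
move=> /continuousP cf; apply: (measurability _ (RGenOpens.measurableE R)).
move=> _ [_ [a [b ->] <-]]; rewrite setTI; apply: open_measurable_rV.
exact/cf/interval_open.
Qed.

Let cube n (M : R) : set 'rV[R]_n :=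
  [set x | forall i, `[- M, M]%classic (x ord0 i)].

Let measurable_cube n (M : R) : measurable (@cube n M).
Proof. by apply: (@measurable_box n (fun=> `[- M, M]%classic)) => i. Qed.

(** Induction along the recursive construction of the measure: the preimage of a cube under
    [snoc_rV] is a cube of one dimension less times a segment. The base case is a Dirac mass. *)
Lemma lebesgue_rV_cube_lty n (M : R) : (lebesgue_rV (@cube n M) < +oo)%E.
Proof.
have segment_lty : (lebesgue_measure (`[(- M)%R, M]%classic : set R) < +oo)%E.
  by rewrite lebesgue_measure_itv/=; case: ifP => // _; rewrite -EFinB ltry.
elim: n => [|n IH] /=.
  by rewrite diracE ltry.
rewrite /pushforward.
rewrite (_ : _ @^-1` _ =
    @cube n M `*` `[- M, M]%classic).
  rewrite product_measure1E//; last exact: measurable_cube.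
  by rewrite lte_mul_pinfty// ge0_fin_numE.
apply/seteqP; split => [[x y]/= H|[x y]/= [Hx Hy] i].
  split => [i|].
    by have := H (lift ord_max i); rewrite mxE liftK.
  by have := H ord_max; rewrite mxE unlift_none.
by rewrite mxE; case: unliftP => [j _|_].
Qed.

Let bounded_sub_cube n (A : set 'rV[R]_n) :
  bounded_set A -> exists M, A `<=` @cube n M.
Proof.
(* Boundedness provides the norm bound for every real strictly above [M], whence [M + 1]. *)
move=> [M [Mreal MA]]; exists (M + 1) => x Ax i; rewrite /= in_itv /= -ler_norml.
have := MA (M + 1) _ x Ax; rewrite ltrDl ltr01 => /(_ isT).
rewrite {1}/Num.norm/= mx_normrE => /bigmax_leP[_ /(_ (ord0, i))] /=.
exact.
Qed.

Lemma bounded_lebesgue_rV_lty n (A : set 'rV[R]_n) :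
  measurable A -> bounded_set A -> (lebesgue_rV A < +oo)%E.
Proof.
move=> mA /bounded_sub_cube[M AM].
apply: le_lt_trans (lebesgue_rV_cube_lty n M).
by apply: le_measure; rewrite ?inE//; exact: measurable_cube.
Qed.

(** Compactness is taken from a cube enclosing [A], so that open sets such as the domain are
    covered. *)
Lemma continuous_bounded_on n (f : 'rV[R]_n -> R) (A : set 'rV[R]_n) :
  continuous f -> bounded_set A -> exists M, forall x, A x -> `|f x| <= M.
Proof.
move=> cf /bounded_sub_cube[M AM].
have cube_compact : compact (@cube n M).
  by apply: (@rV_compact R n (fun=> `[- M, M]%classic)) => i;
    exact: segment_compact.
have /compact_bounded[N [_ HN]] : compact (f @` @cube n M).
  by apply: continuous_compact => //; exact: continuous_subspaceT.
exists (N + 1) => x /AM Mx; apply: (HN (N + 1)); first by rewrite ltrDl.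
by exists x.
Qed.

(** The constant 1 is in L^2 since [A] has finite measure, and [f] is a bounded multiplier on [A].
    This puts test functions and their partial derivatives in L^2 of the domain. *)
Lemma bounded_L2 n (A : set 'rV[R]_n) (f : 'rV[R]_n -> R) :
  measurable A -> bounded_set A -> continuous f -> L2 lebesgue_rV A f.
Proof.
move=> mA bA cf; have [M fM] := continuous_bounded_on cf bA.
have L2_1 : L2 (@lebesgue_rV R n) A (cst 1).
  apply/L2P; split.
    by apply: (measurable_restrictT (cst 1 : 'rV[R]_n -> R) mA).1.
  apply: le_lt_trans (bounded_lebesgue_rV_lty mA bA).
  rewrite -[leRHS]mul1e -integral_cst// [leRHS]integral_mkcond.
  rewrite le_eqVlt; apply/orP; left; apply/eqP; apply: eq_integral => x _.
  by rewrite /patch; case: ifPn => _; rewrite /= ?expr1n ?expr0n.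
have := @L2_bounded_mul _ _ _ lebesgue_rV A f (cst 1) M _ _ L2_1.
under [X in (_ -> _ -> L2 _ _ X) -> _]eq_fun do rewrite /= mulr1.
apply; last by apply/nearW.
apply/(measurable_restrictT _ mA)/measurable_funTS.
exact: continuous_measurable_rV.
Qed.

End measure_rV.

(** * Smooth functions, H^1 and H(div) *)

Section smooth_difference.
Context (R : realType) (n : nat).
Implicit Types f g : 'rV[R]_n -> R.

Lemma partialB f g i : (forall x, derivable f x (delta_mx ord0 i)) ->
  (forall x, derivable g x (delta_mx ord0 i)) ->
  partial i (fun x => f x - g x) = (fun x => partial i f x - partial i g x).
Proof. by move=> df dg; apply/funext => x; exact: (deriveB (df x) (dg x)). Qed.

Lemma CkB k f g : Ck k f -> Ck k g -> Ck k (fun x => f x - g x).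
Proof.
elim: k f g => [|k IH] f g /=; first by move=> cf cg x;
  exact: (continuousB (cf x) (cg x)).
move=> [cf df Cf] [cg dg Cg]; split.
- by move=> x; exact: (continuousB (cf x) (cg x)).
- by move=> i x; exact: (derivableB (df i x) (dg i x)).
- by move=> i; rewrite partialB//; exact: IH.
Qed.

Lemma smoothB f g : smooth f -> smooth g -> smooth (fun x => f x - g x).
Proof. by move=> sf sg k; apply: CkB; [exact: (sf k)|exact: (sg k)]. Qed.

Lemma smooth_continuous f : smooth f -> continuous f.
Proof. by move=> /(_ 0%N). Qed.

Lemma smooth_derivable f i x : smooth f -> derivable f x (delta_mx ord0 i).
Proof. by move=> /(_ 1%N)[]. Qed.

Lemma smooth_partial_continuous f i : smooth f -> continuous (partial i f).
Proof. by move=> /(_ 1%N)[]. Qed.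

End smooth_difference.

Section dot.
Context (R : realType) (n : nat).
Implicit Types x y z : 'rV[R]_n.

Lemma dotC x y : dot x y = dot y x.
Proof. by apply: eq_bigr => i _; rewrite mulrC. Qed.

Lemma dotDl x y z : dot (x + y) z = dot x z + dot y z.
Proof. by rewrite -big_split; apply: eq_bigr => i _; rewrite mxE mulrDl. Qed.

Lemma dotZl k x z : dot (k *: x) z = k * dot x z.
Proof. by rewrite /dot mulr_sumr; apply: eq_bigr => i _; rewrite mxE mulrA. Qed.

Lemma dot_ge0 x : 0 <= dot x x.
Proof. by apply: sumr_ge0 => i _; rewrite -expr2 sqr_ge0. Qed.

End dot.

Section sobolev_spaces.
Context (R : realType) (n : nat) (Omega : polyhedral_domain R n).
Local Notation space := 'rV[R]_n.+1.
Local Notation leb := (@lebesgue_rV R n.+1).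
Local Notation surf := (surface_measure Omega).
Implicit Types (u v w : space -> space).

Lemma measurable_dom : measurable (dom Omega).
Proof. by apply: open_measurable_rV; exact: dom_open. Qed.

Lemma measurable_boundary : measurable (boundary (dom Omega)).
Proof.
apply: measurableD; last by apply: open_measurable_rV; exact: open_interior.
rewrite -[X in measurable X]setCK; apply: measurableC.
by apply: open_measurable_rV; apply: closed_openC; exact: closed_closure.
Qed.

Lemma continuous_L2 (f : space -> R) : continuous f -> L2 leb Omega f.
Proof. by apply: bounded_L2; [exact: measurable_dom|exact: dom_bounded]. Qed.

Lemma L2vecD v w : L2vec Omega v -> L2vec Omega w ->
  L2vec Omega (fun x => v x + w x).
Proof.
move=> L2v L2w i; under [X in L2 _ _ X]eq_fun do rewrite mxE.
exact: L2D.
Qed.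

Lemma L2vecZ k v : L2vec Omega v -> L2vec Omega (fun x => k *: v x).
Proof.
move=> L2v i; under [X in L2 _ _ X]eq_fun do rewrite mxE.
exact: L2Z.
Qed.

Lemma L2vecN v : L2vec Omega v -> L2vec Omega (fun x => - v x).
Proof. by move/(L2vecZ (-1)); under eq_fun do rewrite scaleN1r. Qed.

Lemma L2vecB v w : L2vec Omega v -> L2vec Omega w ->
  L2vec Omega (fun x => v x - w x).
Proof. by move=> L2v /L2vecN; exact: L2vecD. Qed.

Lemma integrable_on_dot v w : L2vec Omega v -> L2vec Omega w ->
  integrable_on leb Omega (fun x => dot (v x) (w x)).
Proof.
move=> L2v L2w; apply: integrable_on_sum => i.
exact: (integrable_onM _ (L2v i) (L2w i)).
Qed.

Lemma vec_ipC v w : vec_ip Omega v w = vec_ip Omega w v.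
Proof. by apply: eq_Rintegral => x _; exact: dotC. Qed.

Lemma vec_ipDl u v w : L2vec Omega u -> L2vec Omega v -> L2vec Omega w ->
  vec_ip Omega (fun x => u x + v x) w = vec_ip Omega u w + vec_ip Omega v w.
Proof.
move=> L2u L2v L2w; rewrite -Rintegral_onD; try exact: integrable_on_dot.
by apply: eq_Rintegral => x _; exact: dotDl.
Qed.

Lemma vec_ipZl k v w : L2vec Omega v -> L2vec Omega w ->
  vec_ip Omega (fun x => k *: v x) w = k * vec_ip Omega v w.
Proof.
move=> L2v L2w; rewrite -Rintegral_onZ; last exact: integrable_on_dot.
by apply: eq_Rintegral => x _; exact: dotZl.
Qed.

Lemma vec_ipBl u v w : L2vec Omega u -> L2vec Omega v -> L2vec Omega w ->
  vec_ip Omega (fun x => u x - v x) w = vec_ip Omega u w - vec_ip Omega v w.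
Proof.
move=> L2u L2v L2w; under [X in vec_ip _ X _]eq_fun do rewrite -scaleN1r.
by rewrite vec_ipDl// ?vec_ipZl ?mulN1r//; exact: L2vecZ.
Qed.

Lemma ae_eq_vec_ip u v w : L2vec Omega u -> L2vec Omega v -> L2vec Omega w ->
  {ae leb, forall x, dom Omega x -> u x = v x} ->
  vec_ip Omega u w = vec_ip Omega v w.
Proof.
move=> L2u L2v L2w uv; apply: ae_eq_Rintegral_on; try exact: integrable_on_dot.
by move: uv; apply: filterS => x uv Ox; rewrite uv.
Qed.

Lemma is_weak_gradientB (w1 w2 : space -> R) (G1 G2 : space -> space) :
  L2 leb Omega w1 -> L2 leb Omega w2 -> L2vec Omega G1 -> L2vec Omega G2 ->
  is_weak_gradient Omega w1 G1 -> is_weak_gradient Omega w2 G2 ->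
  is_weak_gradient Omega (fun x => w1 x - w2 x) (fun x => G1 x - G2 x).
Proof.
move=> L2w1 L2w2 L2G1 L2G2 g1 g2 phi phi_test i; have [sphi _] := phi_test.
have L2phi := continuous_L2 (smooth_continuous sphi).
have L2dphi := continuous_L2 (@smooth_partial_continuous _ _ _ i sphi).
under eq_Rintegral do rewrite mulrBl.
under [in RHS]eq_Rintegral do rewrite !mxE mulrBl.
rewrite !Rintegral_onB; first by rewrite g1// g2//; ring.
- exact: (integrable_onM _ (L2G1 i) L2phi).
- exact: (integrable_onM _ (L2G2 i) L2phi).
- exact: (integrable_onM _ L2w1 L2dphi).
- exact: (integrable_onM _ L2w2 L2dphi).
Qed.

Lemma measurable_restrict_sub (A : set space) (f g : space -> R) :
  measurable A -> continuous f -> measurable_fun setT (g \_ A) ->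
  measurable_fun setT ((fun x => f x - g x) \_ A).
Proof.
move=> mA cf mg.
have -> : (fun x => f x - g x) \_ A = (f \_ A) \- (g \_ A).
  by apply/funext => x; rewrite /patch /=; case: ifPn; rewrite ?subr0.
apply: measurable_funB => //; apply/(measurable_restrictT _ mA)/measurable_funTS.
exact: continuous_measurable_rV.
Qed.

(** The differences of the two approximating sequences are smooth and converge in all three
    norms. *)
Lemma is_traceB (w1 w2 : space -> R) (G1 G2 : space -> space) (t1 t2 : space -> R) :
  L2 leb Omega w1 -> L2 leb Omega w2 -> L2vec Omega G1 -> L2vec Omega G2 ->
  is_trace Omega w1 G1 t1 -> is_trace Omega w2 G2 t2 ->
  is_trace Omega (fun x => w1 x - w2 x) (fun x => G1 x - G2 x)
    (fun x => t1 x - t2 x).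
Proof.
move=> L2w1 L2w2 L2G1 L2G2 [L2t1 [phi [sphi phiw phiG phit]]].
move=> [L2t2 [psi [spsi psiw psiG psit]]]; split; first exact: L2B.
have mOmega := measurable_dom; have mbd := measurable_boundary.
exists (fun k x => phi k x - psi k x); split.
- by move=> k; exact: smoothB.
- apply: L2norm_cvgB => // k; apply: measurable_restrict_sub => //.
  + exact: smooth_continuous.
  + exact: L2_measurable L2w1.
  + exact: smooth_continuous.
  + exact: L2_measurable L2w2.
- move=> i.
  have -> : (fun k => L2norm leb Omega (fun x =>
      partial i (fun y => phi k y - psi k y) x - (G1 x - G2 x) ord0 i)) =
    (fun k => L2norm leb Omega (fun x =>
      (partial i (phi k) x - partial i (psi k) x) - (G1 x ord0 i - G2 x ord0 i))).
    apply/funext => k; rewrite partialB; last 2 first.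
    + by move=> x; exact: smooth_derivable.
    + by move=> x; exact: smooth_derivable.
    by congr L2norm; apply/funext => x; rewrite !mxE.
  apply: L2norm_cvgB => // k; apply: measurable_restrict_sub => //.
  + exact: smooth_partial_continuous.
  + exact: L2_measurable (L2G1 i).
  + exact: smooth_partial_continuous.
  + exact: L2_measurable (L2G2 i).
- apply: L2norm_cvgB => // k; apply: measurable_restrict_sub => //.
  + exact: smooth_continuous.
  + exact: L2_measurable L2t1.
  + exact: smooth_continuous.
  + exact: L2_measurable L2t2.
Qed.

(** Subtraction in H^1, acting on function, gradient and trace at once; it supplies u - uh as a test
    function. *)
Definition H1B (w1 w2 : H1 Omega) : H1 Omega :=
  MkH1 (L2B (H1_L2 w1) (H1_L2 w2)) (L2vecB (grad_L2 w1) (grad_L2 w2))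
    (is_weak_gradientB (H1_L2 w1) (H1_L2 w2) (grad_L2 w1) (grad_L2 w2)
      (gradP w1) (gradP w2))
    (is_traceB (H1_L2 w1) (H1_L2 w2) (grad_L2 w1) (grad_L2 w2)
      (traceP w1) (traceP w2)).

Lemma trace_L2 (w : H1 Omega) : L2 surf (boundary Omega) (trace w).
Proof. by have [] := traceP w. Qed.

Lemma trace_eqB (Gamma : set space) (w1 w2 : H1 Omega) (g : space -> R) :
  trace_eq Gamma w1 g -> trace_eq Gamma w2 g ->
  trace_eq Gamma (H1B w1 w2) (fun=> 0).
Proof.
by apply: filterS2 => x w1g w2g Gx; rewrite /= w1g// w2g// subrr.
Qed.

Lemma ipBr (f : space -> R) (w1 w2 : H1 Omega) : L2 leb Omega f ->
  ip Omega f (H1B w1 w2) = ip Omega f w1 - ip Omega f w2.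
Proof.
move=> L2f; have L2w1 := H1_L2 w1; have L2w2 := H1_L2 w2.
rewrite -Rintegral_onB; first by apply: eq_Rintegral => x _; rewrite -mulrBr.
- exact: (integrable_onM _ L2f L2w1).
- exact: (integrable_onM _ L2f L2w2).
Qed.

Lemma ae_eq_ip (f g h : space -> R) :
  L2 leb Omega f -> L2 leb Omega g -> L2 leb Omega h ->
  {ae leb, forall x, dom Omega x -> f x = g x} -> ip Omega f h = ip Omega g h.
Proof.
move=> L2f L2g L2h fg; apply: ae_eq_Rintegral_on.
- exact: (integrable_onM _ L2f L2h).
- exact: (integrable_onM _ L2g L2h).
- by move: fg; apply: filterS => x fg Ox; rewrite fg.
Qed.

Lemma vec_ip_gradB v (w1 w2 : H1 Omega) : L2vec Omega v ->
  vec_ip Omega v (grad (H1B w1 w2)) =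
  vec_ip Omega v (grad w1) - vec_ip Omega v (grad w2).
Proof.
move=> L2v; rewrite !(vec_ipC v) -vec_ipBl//; exact: grad_L2.
Qed.

Lemma normal_pairingB (v : Hdiv Omega) (w1 w2 : H1 Omega) :
  normal_pairing v (H1B w1 w2) = normal_pairing v w1 - normal_pairing v w2.
Proof.
rewrite /normal_pairing vec_ip_gradB ?ipBr; first by ring.
  exact: divergence_L2.
exact: Hdiv_L2.
Qed.

(** * Pairings with normal traces on the two parts of the boundary *)

Section boundary_parts.
Context (GammaD GammaN : set space).
Hypothesis GammaN_boundary : GammaN `<=` boundary Omega.

Lemma boundary_ipBr (h : space -> R) (w1 w2 : H1 Omega) : L2 surf GammaN h ->
  boundary_ip Omega GammaN h (trace (H1B w1 w2)) =
  boundary_ip Omega GammaN h (trace w1) - boundary_ip Omega GammaN h (trace w2).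
Proof.
move=> L2h; have L2t1 := trace_L2 w1; have L2t2 := trace_L2 w2.
rewrite -Rintegral_onB; first by apply: eq_Rintegral => x _; rewrite -mulrBr.
- exact: (integrable_onM GammaN_boundary L2h L2t1).
- exact: (integrable_onM GammaN_boundary L2h L2t2).
Qed.

Lemma boundary_ipNl (h : space -> R) (w : H1 Omega) : L2 surf GammaN h ->
  boundary_ip Omega GammaN (fun x => - h x) (trace w) =
  - boundary_ip Omega GammaN h (trace w).
Proof.
move=> L2h; have L2t := trace_L2 w.
rewrite -mulN1r -Rintegral_onZ; last first.
  exact: (integrable_onM GammaN_boundary L2h L2t).
by apply: eq_Rintegral => x _; rewrite mulN1r mulNr.
Qed.

(** [normal_traceN] is a choice with a default; the witness [h] guarantees that the chosen function,
    possibly another representative, is a genuine normal trace. *)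
Lemma normal_traceNP (v : Hdiv Omega) (h : space -> R) :
  normal_trace_eq GammaD GammaN v h ->
  normal_trace_eq GammaD GammaN v (normal_traceN GammaD GammaN v).
Proof.
move=> vh; apply: (@xgetPex _ _ [set k | normal_trace_eq GammaD GammaN v k]).
by exists h.
Qed.

(** Any lifting of [g] may be used: two liftings differ by a function vanishing on [GammaD], for
    which the whole pairing reduces to its [GammaN] part. *)
Lemma dual_pairingDE (g : space -> R) (v : Hdiv Omega) (h : space -> R)
    (w : H1 Omega) :
  normal_trace_eq GammaD GammaN v h -> trace_eq GammaD w g ->
  dual_pairingD GammaD GammaN g v = normal_pairingD GammaD GammaN v w.
Proof.
move=> /normal_traceNP[L2N vN] wg; apply: get_unique; first by exists w.
move=> _ [w' w'g ->]; rewrite /normal_pairingD.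
have := vN _ (trace_eqB w'g wg); rewrite normal_pairingB boundary_ipBr// => E.
lra.
Qed.

(* Both fields select the same representative of the normal trace on GammaN,
   because the sets of candidates coincide. *)
Lemma normal_traceN_eq (v1 v2 : Hdiv Omega) (h : space -> R) :
  normal_trace_eq GammaD GammaN v1 h -> normal_trace_eq GammaD GammaN v2 h ->
  normal_traceN GammaD GammaN v1 = normal_traceN GammaD GammaN v2.
Proof.
move=> [_ v1h] [_ v2h]; congr xget; apply/seteqP; split=> k [L2k vk];
  split=> // w w0.
- by rewrite v2h// -v1h// vk.
- by rewrite v1h// -v2h// vk.
Qed.

(** After lifting [g] to [w], the divergence terms and the [GammaN] terms of the two fields cancel,
    and only the gradient term of Green's formula survives. *)
Lemma dual_pairingDB (g f : space -> R) (v1 v2 : Hdiv Omega) (h : space -> R)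
    (w : H1 Omega) : L2 leb Omega f ->
  normal_trace_eq GammaD GammaN v1 h -> normal_trace_eq GammaD GammaN v2 h ->
  {ae leb, forall x, dom Omega x -> divergence v1 x = f x} ->
  {ae leb, forall x, dom Omega x -> divergence v2 x = f x} ->
  trace_eq GammaD w g ->
  dual_pairingD GammaD GammaN g v1 - dual_pairingD GammaD GammaN g v2 =
  vec_ip Omega (fun x => v1 x - v2 x) (grad w).
Proof.
move=> L2f v1h v2h dv1 dv2 wg.
rewrite (dual_pairingDE v1h wg) (dual_pairingDE v2h wg).
rewrite /normal_pairingD (normal_traceN_eq v1h v2h) /normal_pairing.
rewrite (ae_eq_ip _ L2f _ dv1) ?(ae_eq_ip _ L2f _ dv2); try exact: divergence_L2.
- rewrite vec_ipBl; first by ring.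
  + exact: Hdiv_L2.
  + exact: Hdiv_L2.
  + exact: grad_L2.
- exact: H1_L2.
- exact: H1_L2.
Qed.

(** Green's formula for [w] vanishing on [GammaD]: both fields have the same boundary term and the
    same divergence term. This is the source of the orthogonality of the two errors. *)
Lemma vec_ip_grad0 (f : space -> R) (v1 v2 : Hdiv Omega) (h : space -> R)
    (w : H1 Omega) : L2 leb Omega f ->
  normal_trace_eq GammaD GammaN v1 h -> normal_trace_eq GammaD GammaN v2 h ->
  {ae leb, forall x, dom Omega x -> divergence v1 x = f x} ->
  {ae leb, forall x, dom Omega x -> divergence v2 x = f x} ->
  trace_eq GammaD w (fun=> 0) ->
  vec_ip Omega (fun x => v1 x - v2 x) (grad w) = 0.
Proof.
move=> L2f [_ v1h] [_ v2h] dv1 dv2 w0.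
have := v1h w w0; rewrite -v2h// /normal_pairing.
rewrite (ae_eq_ip _ L2f _ dv1) ?(ae_eq_ip _ L2f _ dv2); try exact: divergence_L2.
- move=> /addIr E; rewrite vec_ipBl ?E ?subrr//.
  + exact: Hdiv_L2.
  + exact: Hdiv_L2.
  + exact: grad_L2.
- exact: H1_L2.
- exact: H1_L2.
Qed.

End boundary_parts.

End sobolev_spaces.

(** * The energy inner product *)

Section energy.
Context (R : realType) (n : nat) (Omega : polyhedral_domain R n).
Variable nu : 'rV[R]_n.+1 -> R.
Hypothesis nu_coef : diffusion_coefficient Omega nu.
Local Notation space := 'rV[R]_n.+1.
Local Notation leb := (@lebesgue_rV R n.+1).
Implicit Types (u v w : space -> space).

Lemma nu_gt0 x : dom Omega x -> 0 < nu x.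
Proof. by case: nu_coef => _ + _; exact. Qed.

(** A general [h] treats [nu] and its inverse together. Almost everywhere [h (nu x)] is one of
    finitely many values, each dominated by the sum of all their absolute values. *)
Lemma coefficient_bounded (h : R -> R) :
  exists M, {ae leb, forall x, dom Omega x -> `|h (nu x)| <= M}.
Proof.
have [_ _ [N [sub [c [_ _ nuc cover]]]]] := nu_coef.
exists (\sum_(k < N) `|h (c k)|).
move: cover; apply: filterS => x cover /cover[k /nuc ->].
by rewrite (bigD1 k)//= lerDl sumr_ge0.
Qed.

Lemma L2vec_coefficient (h : R -> R) v : measurable_fun (dom Omega) (h \o nu) ->
  L2vec Omega v -> L2vec Omega (fun x => h (nu x) *: v x).
Proof.
move=> mh L2v i; under [X in L2 _ _ X]eq_fun do rewrite mxE.
have [M hM] := coefficient_bounded h.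
apply: (@L2_bounded_mul _ _ _ _ _ (h \o nu) _ M _ hM (L2v i)).
exact/(measurable_restrictT _ (measurable_dom Omega)).
Qed.

Lemma L2vec_nuZ v : L2vec Omega v -> L2vec Omega (fun x => nu x *: v x).
Proof. by apply: (@L2vec_coefficient id); case: nu_coef. Qed.

Lemma L2vec_nuVZ v : L2vec Omega v -> L2vec Omega (fun x => (nu x)^-1 *: v x).
Proof.
apply: (@L2vec_coefficient GRing.inv).
(* Where [nu] is positive, the inverse is the real power of exponent -1, whose measurability is
   known. *)
apply: (eq_measurable_fun (fun x => nu x `^ (-1))).
  by move=> x /set_mem Ox; rewrite powR_inv1// ltW// nu_gt0.
by case: nu_coef => mnu _ _; exact: (measurableT_comp (measurable_powR _) mnu).
Qed.

Lemma energy_ipC v w : energy_ip Omega nu v w = energy_ip Omega nu w v.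
Proof.
apply: eq_Rintegral => x _; rewrite dotZl [in RHS]dotZl; congr (_ * _).
exact: dotC.
Qed.

Lemma energy_ipDl u v w : L2vec Omega u -> L2vec Omega v -> L2vec Omega w ->
  energy_ip Omega nu (fun x => u x + v x) w =
  energy_ip Omega nu u w + energy_ip Omega nu v w.
Proof.
move=> L2u L2v L2w; rewrite /energy_ip.
under [X in vec_ip _ X _ = _]eq_fun do rewrite scalerDr.
by rewrite vec_ipDl//; exact: L2vec_nuVZ.
Qed.

Lemma energy_ipZl k v w : L2vec Omega v -> L2vec Omega w ->
  energy_ip Omega nu (fun x => k *: v x) w = k * energy_ip Omega nu v w.
Proof.
move=> L2v L2w; rewrite /energy_ip.
under [X in vec_ip _ X _ = _]eq_fun do rewrite scalerA mulrC -scalerA.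
by rewrite vec_ipZl//; exact: L2vec_nuVZ.
Qed.

Lemma energy_ipBl u v w : L2vec Omega u -> L2vec Omega v -> L2vec Omega w ->
  energy_ip Omega nu (fun x => u x - v x) w =
  energy_ip Omega nu u w - energy_ip Omega nu v w.
Proof.
move=> L2u L2v L2w; under [X in energy_ip _ _ X _]eq_fun do rewrite -scaleN1r.
by rewrite energy_ipDl// ?energy_ipZl ?mulN1r//; exact: L2vecZ.
Qed.

Lemma energy_ip_ge0 v : 0 <= energy_ip Omega nu v v.
Proof.
apply: Rintegral_ge0 => x Ox; rewrite dotZl mulr_ge0 ?dot_ge0//.
by rewrite invr_ge0 ltW// nu_gt0.
Qed.

(** The weights cancel pointwise on the domain; this turns energy products with [nu] times a
    gradient into the volume terms of Green's formula. *)
Lemma energy_ip_nuZr v w :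
  energy_ip Omega nu v (fun x => nu x *: w x) = vec_ip Omega v w.
Proof.
apply: eq_Rintegral => x /set_mem Ox.
rewrite dotZl dotC dotZl dotC mulrA mulVf ?mul1r//.
by rewrite gt_eqF// nu_gt0.
Qed.

(** Nonnegativity of the energy of [v + t w] for all [t] is a statement on a quadratic polynomial.
    The form is only semidefinite on functions, hence the separate case of a zero leading
    coefficient. *)
Lemma energy_cauchy_schwarz v w : L2vec Omega v -> L2vec Omega w ->
  `|energy_ip Omega nu v w| <= energy_norm Omega nu v * energy_norm Omega nu w.
Proof.
move=> L2v L2w; rewrite /energy_norm.
set a := energy_ip _ _ v v; set b := energy_ip _ _ v w.
set c := energy_ip _ _ w w.
have a0 : 0 <= a := energy_ip_ge0 v.
have c0 : 0 <= c := energy_ip_ge0 w.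
have quadratic t : 0 <= a + 2 * t * b + t ^+ 2 * c.
  have := energy_ip_ge0 (fun x => v x + t *: w x).
  have L2tw := L2vecZ t L2w; have L2vtw := L2vecD L2v L2tw.
  rewrite energy_ipDl// energy_ipZl// ![energy_ip _ _ _ (fun x => _ + _)]energy_ipC.
  rewrite !energy_ipDl// !energy_ipZl// (energy_ipC w v) -/a -/b -/c.
  by congr (0 <= _); ring.
rewrite -sqrtrM// -sqrtr_sqr ler_wsqrtr//.
have [c_eq0|c_neq0] := eqVneq c 0.
  have [->|b_neq0] := eqVneq b 0; first by rewrite expr0n /= mulr_ge0.
  (* With [c = 0] the polynomial is affine in [t]; this [t] gives it the value -1, a
     contradiction. *)
  have := quadratic (- (a + 1) / (2 * b)); rewrite c_eq0.
  have -> : a + 2 * (- (a + 1) / (2 * b)) * b + (- (a + 1) / (2 * b)) ^+ 2 * 0 = -1.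
    by field.
  by rewrite lerNr oppr0 ler10.
have cpos : 0 < c by rewrite lt_def c_neq0.
(* The minimiser of the polynomial. *)
have := quadratic (- b / c).
have -> : a + 2 * (- b / c) * b + (- b / c) ^+ 2 * c = (a * c - b ^+ 2) / c.
  by field.
by rewrite pmulr_lge0 ?invr_gt0// subr_ge0.
Qed.

Lemma energy_ipNl v w : L2vec Omega v -> L2vec Omega w ->
  energy_ip Omega nu (fun x => - v x) w = - energy_ip Omega nu v w.
Proof.
move=> L2v L2w; under [X in energy_ip _ _ X _]eq_fun do rewrite -scaleN1r.
by rewrite energy_ipZl// mulN1r.
Qed.

Lemma energy_ipDr u v w : L2vec Omega u -> L2vec Omega v -> L2vec Omega w ->
  energy_ip Omega nu w (fun x => u x + v x) =
  energy_ip Omega nu w u + energy_ip Omega nu w v.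
Proof. by move=> *; rewrite !(energy_ipC w) energy_ipDl. Qed.

Lemma energy_ipBr u v w : L2vec Omega u -> L2vec Omega v -> L2vec Omega w ->
  energy_ip Omega nu w (fun x => u x - v x) =
  energy_ip Omega nu w u - energy_ip Omega nu w v.
Proof. by move=> *; rewrite !(energy_ipC w) energy_ipBl. Qed.

(* With v = -(a + b), the quantity inside the absolute value is
   (a - b, z + y) / 2, and |||a - b||| = |||a + b||| by orthogonality. *)
Lemma energy_orthogonal_bound a b v y z :
  L2vec Omega a -> L2vec Omega b -> L2vec Omega y -> L2vec Omega z ->
  v = (fun x => - (a x + b x)) -> energy_ip Omega nu a b = 0 ->
  `|energy_ip Omega nu a y - energy_ip Omega nu z b
    - 2^-1 * energy_ip Omega nu v (fun x => z x - y x)| <=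
  2^-1 * (energy_norm Omega nu v * energy_norm Omega nu (fun x => z x + y x)).
Proof.
move=> L2a L2b L2y L2z vE ab0; have ba0 := ab0; rewrite energy_ipC in ba0.
have L2s := L2vecD L2a L2b; have L2d := L2vecB L2a L2b.
have L2zy := L2vecD L2z L2y; have L2zmy := L2vecB L2z L2y.
have L2v : L2vec Omega v by rewrite vE; exact: L2vecN.
have -> : energy_norm Omega nu v = energy_norm Omega nu (fun x => a x - b x).
  congr Num.sqrt; rewrite {1}vE energy_ipNl// energy_ipC vE energy_ipNl//.
  rewrite energy_ipBl// !energy_ipBr// energy_ipDl// !energy_ipDr// ab0 ba0.
  by ring.
have -> : energy_ip Omega nu a y - energy_ip Omega nu z b
    - 2^-1 * energy_ip Omega nu v (fun x => z x - y x) =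
    2^-1 * energy_ip Omega nu (fun x => a x - b x) (fun x => z x + y x).
  rewrite vE energy_ipNl// energy_ipBl// !energy_ipBr//.
  rewrite !energy_ipDl// !energy_ipDr// (energy_ipC z b).
  by field.
rewrite normrM ger0_norm ?invr_ge0// ler_wpM2l ?invr_ge0//.
exact: energy_cauchy_schwarz.
Qed.

End energy.

(** * Two-sided bounds for the quantity of interest *)

Theorem theorem1 (R : realType) (n : nat)
  (dim23 : n.+1 = 2%N \/ n.+1 = 3%N)
  (Omega : polyhedral_domain R n) (GammaD GammaN : set 'rV[R]_n.+1)
  (Gamma_partition : boundary_partition Omega GammaD GammaN)
  (nu : 'rV[R]_n.+1 -> R) (nu_coef : diffusion_coefficient Omega nu)
  (f gD gN fO gDO gNO : 'rV[R]_n.+1 -> R)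
  (data : admissible_data Omega GammaD GammaN f gD gN)
  (dataO : admissible_data Omega GammaD GammaN fO gDO gNO)
  (u : H1 Omega) (q : Hdiv Omega)
  (primal : weak_solution GammaD GammaN nu f gD gN u q)
  (xi : H1 Omega) (zeta : Hdiv Omega)
  (adjoint : weak_solution GammaD GammaN nu fO gDO (fun x => - gNO x) xi zeta)
  (uh : H1 Omega) (qh : Hdiv Omega)
  (primal_rec : reconstruction GammaD GammaN f gD gN uh qh)
  (xih : H1 Omega) (zetah : Hdiv Omega)
  (adjoint_rec :
     reconstruction GammaD GammaN fO gDO (fun x => - gNO x) xih zetah) :
  let ell := output_functional GammaD GammaN fO gDO gNO in
  let s := ell u q in
  let eq_plus := fun x => qh x + nu x *: grad uh x in
  let ez_plus := fun x => zetah x + nu x *: grad xih x in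
  let ez_minus := fun x => zetah x - nu x *: grad xih x in
  let s_minus := ell uh qh + 2^-1 * energy_ip Omega nu eq_plus ez_minus
    - 2^-1 * (energy_norm Omega nu eq_plus * energy_norm Omega nu ez_plus) in
  let s_plus := ell uh qh + 2^-1 * energy_ip Omega nu eq_plus ez_minus
    + 2^-1 * (energy_norm Omega nu eq_plus * energy_norm Omega nu ez_plus) in
  s_minus <= s /\ s <= s_plus.
Proof.
(* Stated over plain variables: on the integrals themselves, ring and lra do not
   terminate in reasonable time, as they compare atoms up to conversion. *)
have rearrange (a b c a' b' c' v : R) : v + (a - a') = - (c - c') ->
    a + b + c - (a' + b' + c') = b - b' - v.
  by move=> /(canRL (addrK _)) ->; ring.
have lower_bound (t l e p : R) : - p <= t - l - e -> l + e - p <= t.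
  by lra.
have upper_bound (t l e p : R) : t - l - e <= p -> t <= l + e + p.
  by lra.
move=> ell s eq_plus ez_plus ez_minus s_minus s_plus.
have [_ _ GammaN_bd _ _] := Gamma_partition.
have GammaN_boundary : GammaN `<=` boundary Omega.
  by case: GammaN_bd => U _ -> x [].
have [L2f _ _] := data; have [L2fO _ L2gNO] := dataO.
have [q_eq [u_gD div_q qN]] := primal.
have [uh_gD div_qh qhN] := primal_rec.
have [xih_gDO div_zetah [L2NgNO zetahN]] := adjoint_rec.
have eu_D : trace_eq GammaD (H1B u uh) (fun=> 0) := trace_eqB u_gD uh_gD.
have L2q := @Hdiv_L2 _ _ _ q; have L2qh := @Hdiv_L2 _ _ _ qh.
have L2zeta := @Hdiv_L2 _ _ _ zetah.
have L2u := @grad_L2 _ _ _ u; have L2uh := @grad_L2 _ _ _ uh.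
have L2X := @grad_L2 _ _ _ xih; have L2G := @grad_L2 _ _ _ (H1B u uh).
(* Using [- nu grad u] in place of [q], equal to it only almost everywhere, makes
   [eq_plus = - (A + B)] an equality of functions; [A_ae] returns to [q - qh] under the integral. *)
pose A := fun x => - (nu x *: grad u x) - qh x.
pose B := fun x => nu x *: grad (H1B u uh) x.
pose X := fun x => nu x *: grad xih x.
have L2nu := L2vec_nuZ nu_coef.
have L2A : L2vec Omega A by apply: L2vecB => //; apply: L2vecN; exact: L2nu.
have L2B : L2vec Omega B by exact: L2nu.
have L2nX : L2vec Omega X by exact: L2nu.
have A_ae w : L2vec Omega w ->
    vec_ip Omega (fun x => q x - qh x) w = vec_ip Omega A w.
  move=> L2w; apply: ae_eq_vec_ip => //; first exact: L2vecB.
  by move: q_eq; apply: filterS => x q_eq Ox; rewrite q_eq.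
have orthogonal : energy_ip Omega nu A B = 0.
  rewrite energy_ip_nuZr// -A_ae//.
  exact: vec_ip_grad0 L2f qN qhN div_q div_qh eu_D.
have error : s - ell uh qh =
    energy_ip Omega nu A X - energy_ip Omega nu zetah B.
  rewrite !energy_ip_nuZr// -A_ae//.
  (* [xih] lifts [gDO], so the product of [q - qh] with its gradient is the difference of the two
     Dirichlet terms of the output. *)
  rewrite -(dual_pairingDB GammaN_boundary L2f qN qhN div_q div_qh xih_gDO).
  (* Testing [zetah] with u - uh yields the remaining differences: its divergence [fO] gives the
     source terms, its flux [- gNO] the Neumann terms. *)
  have := zetahN _ eu_D; rewrite /normal_pairing boundary_ipNl//.
  rewrite (ae_eq_ip _ L2fO _ div_zetah); last 2 first.
  - exact: divergence_L2.
  - exact: H1_L2.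
  rewrite ipBr// boundary_ipBr// /s /ell /output_functional.
  exact: rearrange.
have eq_plusE : eq_plus = (fun x => - (A x + B x)).
  by apply/funext => x; apply/rowP => i; rewrite !mxE; ring.
have := energy_orthogonal_bound nu_coef L2A L2B L2nX L2zeta eq_plusE orthogonal.
rewrite -error ler_norml => /andP[lower upper].
by split; [exact: lower_bound lower | exact: upper_bound upper].
Qed.
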